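(* Let $\mathcal T_1=(S_1,\Sigma_1,\kappa_1)$ be a stochastic transition system and $\mathcal T_2=(S_2,2^{S_2},\kappa_2)$ a denumerable Markov chain which is an $\alpha$-abstraction of $\mathcal T_1$, for a measurable $\alpha:S_1\to S_2$. 1. Assume there is a finite set $A_2=\{s_1,\dots,s_n\}\subseteq S_2$ such that $A_2$ is an attractor for $\mathcal T_2$ and $A_1=\alpha^{-1}(A_2)=\bigcup_{i=1}^n\alpha^{-1}(s_i)$ is an attractor for $\mathcal T_1$. 2. Assume moreover that for every $1\le i\le n$ and every $\alpha$-closed set $B\in\Sigma_1$ there exist $p>0$ and $k\in\mathbb N$ such that: either for every $\mu\in\mathrm{Dist}(\alpha^{-1}(s_i))$, $\mathrm{Prob}^{\mathcal T_1}_\mu(\mathbf F_{\le k}B)\ge p$; or for every $\mu\in\mathrm{Dist}(\alpha^{-1}(s_i))$, $\mathrm{Prob}^{\mathcal T_1}_\mu(\mathbf F B)=0$. Then $\mathcal T_1$ is decisive w.r.t. every $\alpha$-closed set.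
   Context: A stochastic transition system (STS) is $\mathcal T=(S,\Sigma,\kappa)$ where $(S,\Sigma)$ is a measurable space and $\kappa:S\times\Sigma\to[0,1]$ is a Markov kernel. It is a denumerable Markov chain if $S$ is at most countable and $\Sigma=2^S$. $\mathrm{Dist}(S)$ is the set of probability measures on $(S,\Sigma)$; $\mathrm{Dist}(B)$ those with $\mu(B)=1$; $\delta_s$ is the Dirac measure. For $\mu\in\mathrm{Dist}(S)$, $\mathrm{Prob}^{\mathcal T}_\mu$ is the law on infinite paths $s_0s_1\dots\in S^\omega$ (cylinder $\sigma$-algebra) of the Markov chain with initial distribution $\mu$ and kernel $\kappa$. Events: $\mathbf F B$: $\exists i\ge0,\ s_i\in B$; $\mathbf F_{\le k}B$: $\exists\,0\le i\le k,\ s_i\in B$. Avoid-set: $\widetilde B=\{s\in S\mid\mathrm{Prob}^{\mathcal T}_{\delta_s}(\mathbf F B)=0\}$ (measurable). $B\in\Sigma$ is an attractor for $\mathcal T$ if $\mathrm{Prob}^{\mathcal T}_\mu(\mathbf F B)=1$ for every $\mu\in\mathrm{Dist}(S)$. $\mathcal T$ is decisive w.r.t. $B$ if $\mathrm{Prob}^{\mathcal T}_\mu(\mathbf F B\vee\mathbf F\widetilde B)=1$ for every $\mu\in\mathrm{Dist}(S)$. $\Omega_{\mathcal T}(\mu)(A)=\int_S\kappa(s,A)\,\mu(\mathrm ds)$; $\alpha_\#(\mu)(M)=\mu(\alpha^{-1}(M))$. $\mathcal T_2$ is an $\alpha$-abstraction of $\mathcal T_1$ if for every $\mu\in\mathrm{Dist}(S_1)$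 the measures $\alpha_\#(\Omega_{\mathcal T_1}(\mu))$ and $\Omega_{\mathcal T_2}(\alpha_\#(\mu))$ have the same null sets. A set $B\in\Sigma_1$ is $\alpha$-closed if $B=\alpha^{-1}(\alpha(B))$. *)

(* Defs.v *)
From HB Require Import structures.
From mathcomp Require Import all_boot all_order all_algebra.
From mathcomp Require Import all_classical all_reals all_analysis.
From mathcomp Require Import measurable_realfun.

Set Implicit Arguments.
Unset Strict Implicit.
Unset Printing Implicit Defensive.
Import Order.TTheory GRing.Theory Num.Theory.
Import numFieldNormedType.Exports.

Local Open Scope classical_set_scope.
Local Open Scope ring_scope.
Local Open Scope ereal_scope.

Section path_space.
Context d (S : measurableType d).

Definition cylinder (A : (set S)^nat) (n : nat) : set (nat -> S) :=
  [set w | forall i, (i <= n)%N -> A i (w i)].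

(* A measurableType is pointed, so S is nonempty; a system with an empty state
   space has no initial distribution and every path property is vacuous. *)
Definition cylinders : set (set (nat -> S)) :=
  [set C | exists A n, (forall i, measurable (A i)) /\ C = cylinder A n].

Local Notation path_space := (g_sigma_algebraType cylinders).

Lemma cylinders_setI : setI_closed cylinders.
Proof.
move=> _ _ [A [n [mA ->]]] [B [m [mB ->]]].
exists (fun i => (if (i <= n)%N then A i else setT) `&`
                 (if (i <= m)%N then B i else setT)), (maxn n m); split.
  by move=> i; apply: measurableI; case: ifP.
apply/seteqP; split=> w /=.
  move=> [Aw Bw] i _; split; case: ifP => // ?; [exact: Aw|exact: Bw].
move=> ABw; split=> i ile.
  by have := ABw i; rewrite leq_max ile /= => /(_ isT)[].
by have := ABw i; rewrite leq_max ile orbT /= => /(_ isT)[].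
Qed.

Lemma measurable_cylinder (A : (set S)^nat) n : (forall i, measurable (A i)) ->
  measurable (cylinder A n : set path_space).
Proof. by move=> mA; apply: sub_sigma_algebra; exists A, n. Qed.

Lemma measurable_coord i :
  measurable_fun [set: path_space] (fun w : path_space => w i).
Proof.
move=> _ A mA; rewrite setTI.
rewrite (_ : _ @^-1` _ = cylinder (fun m => if m == i then A else setT) i).
  by apply: measurable_cylinder => m; case: ifP.
apply/seteqP; split=> w /= h.
  by move=> m _; case: eqP => // ->.
by have := h i (leqnn _); rewrite eqxx.
Qed.

Lemma measurable_fun_path d' (T : measurableType d') (f : T -> path_space) :
  (forall i, measurable_fun setT (fun x => f x i)) -> measurable_fun setT f.
Proof.
move=> mf; apply: (@measurability _ _ T path_space setT f cylinders) => //.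
move=> _ [_ [A [n [mA ->]]] <-]; rewrite setTI.
rewrite (_ : _ @^-1` _ =
    \bigcap_(i in [set i | (i <= n)%N]) ((fun x => f x i) @^-1` A i)).
  by apply: bigcap_measurableType => i _; rewrite -[X in measurable X]setTI; exact: mf.
by apply/seteqP; split=> x /= h i /h.
Qed.

End path_space.

Notation path_space S := (g_sigma_algebraType (@cylinders _ S)).

Section path_law_def.
Context d (S : measurableType d) (R : realType).
Variable k : R.-pker S ~> S.

(* probability, from state s, that the next n states lie in A 0, ..., A (n - 1)
   successively *)
Fixpoint chain_weight (A : (set S)^nat) (n : nat) (s : S) : \bar R :=
  if n is m.+1 then
    \int[k s]_(t in A 0%N) chain_weight (fun i => A i.+1) m t
  else 1.

Definition is_path_law (mu : probability S R)
    (P : probability (path_space S) R) :=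
  forall (A : (set S)^nat) n, (forall i, measurable (A i)) ->
    P (cylinder A n) =
    \int[mu]_(s in A 0%N) chain_weight (fun i => A i.+1) n s.

Lemma is_path_law_unique mu (P Q : probability (path_space S) R) :
  is_path_law mu P -> is_path_law mu Q ->
  forall E : set (path_space S), measurable E -> P E = Q E.
Proof.
move=> hP hQ.
apply: (@measure_unique _ R (path_space S) (@cylinders _ S) (fun=> setT)) => //.
- exact: cylinders_setI.
- move=> _; exists (fun=> setT), 0%N; split => //.
  by apply/seteqP; split.
- by rewrite bigcup_const.
- by move=> _ [A [n [mA ->]]]; exact: (etrans (hP _ _ mA) (esym (hQ _ _ mA))).
- by move=> _; rewrite [ltLHS](probability_setT P) ltry.
Qed.

End path_law_def.

(* Existence of the path law (Ionescu-Tulcea), through the Caratheodory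
   extension of the premeasure on the ring of finite-horizon events. *)
Module IonescuTulcea.

Section upd.
Context (S : Type).
Implicit Types (w : nat -> S).

Definition upd w j y : nat -> S := fun i => if i == j then y else w i.

Definition agree n w w' := forall i, (i < n)%N -> w i = w' i.

Lemma agree_upd n w y : agree n w (upd w n y).
Proof. by move=> i ilt; rewrite /upd ltn_eqF. Qed.

Definition dep T n (f : (nat -> S) -> T) :=
  forall w w', agree n w w' -> f w = f w'.

Lemma dep_le T m n (f : (nat -> S) -> T) : (m <= n)%N -> dep m f -> dep n f.
Proof. by move=> mn fm w w' ww'; apply: fm => i im; apply/ww'/(leq_trans im). Qed.

Lemma dep_comp2 T T' (op : T -> T -> T') n (f g : (nat -> S) -> T) :
  dep n f -> dep n g -> dep n (fun w => op (f w) (g w)).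
Proof. by move=> df dg w w' ww'; rewrite (df _ _ ww') (dg _ _ ww'). Qed.
Arguments dep_comp2 {T T'} op {n f g}.

Lemma dep_common T (f g : (nat -> S) -> T) m n :
  dep m f -> dep n g -> exists N, dep N f /\ dep N g.
Proof.
move=> df dg; exists (maxn m n); split.
  exact: dep_le (leq_maxl _ _) df.
exact: dep_le (leq_maxr _ _) dg.
Qed.

End upd.

Definition horizon (S : Type) : Type := nat -> S.

Fact horizon_display : measure_display. Proof. exact: default_measure_display. Qed.

Section horizon.
Context d (S : measurableType d).

Definition horizon_measurable : set (set (horizon S)) :=
  [set C | measurable (C : set (path_space S)) /\ exists n, dep n C].

Lemma horizon_measurable0 : horizon_measurable set0.
Proof. by split => //; exists 0%N. Qed.

Lemma horizon_measurableU : setU_closed horizon_measurable.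
Proof.
move=> A B [mA [m dA]] [mB [n dB]]; split; first exact: measurableU.
have [N [{}dA {}dB]] := dep_common dA dB.
by exists N; exact: (dep_comp2 or).
Qed.

Lemma horizon_measurableD : setD_closed horizon_measurable.
Proof.
move=> A B [mA [m dA]] [mB [n dB]]; split; first exact: measurableD.
have [N [{}dA {}dB]] := dep_common dA dB.
by exists N; exact: (dep_comp2 (fun a b => a /\ ~ b)).
Qed.

HB.instance Definition _ := Pointed.copy (horizon S) (nat -> S).
HB.instance Definition _ := @isRingOfSets.Build horizon_display (horizon S)
  horizon_measurable horizon_measurable0 horizon_measurableU
  horizon_measurableD.

Lemma horizon_sigma :
  <<s (horizon_measurable : set (set (horizon S))) >> =
  (measurable : set (set (path_space S))).
Proof.
apply/seteqP; split.
  apply: smallest_sub; first exact: sigma_algebra_measurable.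
  by move=> C [].
apply: smallest_sub; first exact: smallest_sigma_algebra.
move=> _ [A [n [mA ->]]]; apply: sub_sigma_algebra; split.
  exact: measurable_cylinder.
exists n.+1 => w w' ww'; apply/propext; split => h i ilen.
  by rewrite -ww' ?ltnS//; exact: h.
by rewrite ww' ?ltnS//; exact: h.
Qed.

End horizon.

Section construction.
Context d (S : measurableType d) (R : realType).
Variable (k : R.-pker S ~> S) (mu : probability S R).
Local Notation W := (path_space S).
Implicit Types (f g : W -> \bar R) (w : W).

(* law of the j-th state given the states before it *)
Definition next (j : nat) (w : W) : {measure set S -> \bar R} :=
  if j is j'.+1 then k (w j') else mu.

Lemma next_measurable j U :
  measurable U -> measurable_fun [set: W] (next j ^~ U).
Proof.
case: j => [|j] mU; first exact: measurable_cst.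
apply: (measurableT_comp (measurable_kernel k _ mU)).
exact: measurable_coord.
Qed.

HB.instance Definition _ j :=
  isKernel.Build _ _ _ _ R (next j) (@next_measurable j).

Lemma next_setT j w : next j w setT = 1.
Proof. by case: j => [|j] /=; [exact: probability_setT|exact: prob_kernel]. Qed.

HB.instance Definition _ j :=
  Kernel_isProbability.Build _ _ _ _ R (next j) (@next_setT j).

Lemma measurable_upd j :
  measurable_fun [set: W * S] (fun x => upd x.1 j x.2 : W).
Proof.
apply: measurable_fun_path => i; rewrite /upd; case: eqP => _.
  exact: measurable_snd.
exact: (measurableT_comp (measurable_coord i) measurable_fst).
Qed.

Lemma measurable_upd2 j w : measurable_fun [set: S] (fun y => upd w j y : W).
Proof.
apply: measurable_fun_path => i; rewrite /upd; case: eqP => _.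
  exact: measurable_id.
exact: measurable_cst.
Qed.

Definition nice f := (forall w, 0 <= f w) /\ measurable_fun setT f.

Definition step j f w := \int[next j w]_y f (upd w j y).

Lemma nice_step j f : nice f -> nice (step j f).
Proof.
move=> [f0 mf]; split; first by move=> w; exact: integral_ge0.
apply: (measurable_fun_integral_finite_kernel
  (fun x : W * S => f (upd x.1 j x.2)) (next j)) => //.
exact: (measurableT_comp mf (measurable_upd j)).
Qed.

Lemma nice_upd f j w : nice f -> measurable_fun setT (fun y => f (upd w j y)).
Proof. by move=> [_ mf]; exact: measurableT_comp mf (measurable_upd2 j w). Qed.

Lemma step_dep j f : dep j f -> step j f = f.
Proof.
move=> df; apply/funext => w; rewrite /step.
under eq_integral do rewrite -(df w _ (agree_upd w _)).
by rewrite (integral_cst (next j w) measurableT) next_setT mule1.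
Qed.

Lemma stepD j f g : nice f -> nice g ->
  step j (fun w => f w + g w) = (fun w => step j f w + step j g w).
Proof.
move=> nf ng; apply/funext => w; rewrite /step ge0_integralD//.
- by move=> y _; exact: nf.1.
- exact: nice_upd.
- by move=> y _; exact: ng.1.
- exact: nice_upd.
Qed.

Lemma step_gt j f (g : (W -> \bar R)^nat) w :
  nice f -> (forall n, nice (g n)) ->
  \sum_(n <oo) step j (g n) w < step j f w ->
  exists y, \sum_(n <oo) g n (upd w j y) < f (upd w j y).
Proof.
move=> nf ng; apply: contraPP => /forallNP h; apply/negP; rewrite -leNgt.
rewrite /step -integral_nneseries//; last 2 first.
- by move=> n; exact: nice_upd.
- by move=> n y _; exact: (ng n).1.
apply: ge0_le_integral => //.
- by move=> y _; exact: nf.1.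
- exact: nice_upd.
- apply: ge0_emeasurable_sum => [n y _ _|n _]; first exact: (ng n).1.
  exact: nice_upd.
- by move=> y _; rewrite leNgt; apply/negP/h.
Qed.

(* conditional expectation given the first j states, for f of horizon j + m *)
Fixpoint cexp j m f : W -> \bar R :=
  if m is m'.+1 then step j (cexp j.+1 m' f) else f.

Lemma nice_cexp j m f : nice f -> nice (cexp j m f).
Proof. by move=> nf; elim: m j => //= m IH j; exact/nice_step/IH. Qed.

Lemma cexpD j m f g : nice f -> nice g ->
  cexp j m (fun w => f w + g w) = (fun w => cexp j m f w + cexp j m g w).
Proof.
move=> nf ng; elim: m j => //= m IH j.
by rewrite IH stepD//; exact: nice_cexp.
Qed.

Lemma cexp_dep n j m m' f : dep n f -> (n <= j + m)%N -> (m <= m')%N ->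
  cexp j m' f = cexp j m f.
Proof.
move=> df; elim: m j m' => [|m IH] j [|m'] //=; last first.
  by rewrite ltnS addnS -addSn => ? ?; rewrite (IH _ m').
rewrite addn0 => nj _.
have {}df := dep_le nj df; suff -> : cexp j.+1 m' f = f by exact: step_dep.
elim: m' j df {nj} => //= m' IH' j df.
by rewrite IH' ?step_dep//; exact: (dep_le _ df).
Qed.

Definition ind (C : set (horizon S)) : W -> \bar R := fun w => (\1_C w)%:E.

Lemma nice_ind C : horizon_measurable C -> nice (ind C).
Proof.
move=> [mC _]; split; first by move=> w; rewrite lee_fin.
by apply/measurable_EFinP; exact: measurable_indic.
Qed.

Lemma dep_ind n (C : set (horizon S)) : dep n C -> dep n (ind C).
Proof.
move=> dC w w' ww'; have CE := dC _ _ ww'; rewrite /ind !indicE.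
suff -> : ((w : horizon S) \in C) = ((w' : horizon S) \in C) by [].
by apply/idP/idP => /set_mem h; apply/mem_set; [rewrite -CE|rewrite CE].
Qed.

Definition depth (C : set (horizon S)) : nat := get [set n | dep n C].

Lemma depthP C : horizon_measurable C -> dep (depth C) C.
Proof. by move=> [_ [n dC]]; by apply: (@getPex _ [set n | dep n C]); exists n. Qed.

Definition cprob j (C : set (horizon S)) := cexp j (depth C - j) (ind C).

Lemma cprobE j m n C : horizon_measurable C -> dep n C -> (n <= j + m)%N ->
  cprob j C = cexp j m (ind C).
Proof.
move=> mC dC njm; rewrite /cprob.
have dC' := depthP mC.
have le1 : (depth C <= j + (depth C - j))%N by rewrite -leq_subLR.
have [mle|/ltnW lem] := leqP m (depth C - j).
  by rewrite (@cexp_dep n _ m _ _ (dep_ind dC)).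
by rewrite -(@cexp_dep (depth C) _ _ m _ (dep_ind dC')).
Qed.

Lemma nice_cprob j C : horizon_measurable C -> nice (cprob j C).
Proof. by move=> mC; exact/nice_cexp/nice_ind. Qed.

Lemma cprobS j C : horizon_measurable C -> cprob j C = step j (cprob j.+1 C).
Proof.
move=> mC; rewrite (@cprobE j (depth C).+1 (depth C))//; first last.
- by rewrite addnS ltnW// ltnS leq_addl.
- exact: depthP.
rewrite (@cprobE j.+1 (depth C) (depth C))//; first exact: depthP.
exact: leq_addl.
Qed.

Lemma cprob_ind j C : horizon_measurable C -> (depth C <= j)%N ->
  cprob j C = ind C.
Proof. by move=> mC dj; rewrite /cprob (eqP dj). Qed.

Definition premeasure (C : set (horizon S)) : \bar R := cprob 0 C point.

Let premeasure_ge0 C : 0 <= premeasure C.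
Proof.
rewrite /premeasure /cprob; move: (_ - _)%N => m.
elim: m 0%N point => [|m IH] j w /=; first by rewrite lee_fin.
by apply: integral_ge0 => y _; exact: IH.
Qed.

Let premeasure0 : premeasure set0 = 0.
Proof.
rewrite /premeasure (@cprobE 0%N 0%N 0%N) //=; first by rewrite /ind indic0.
exact: horizon_measurable0.
Qed.

Let premeasure_additive : measure_function.semi_additive premeasure.
Proof.
apply/additive2P => // A B mA mB AB0.
have mAB := horizon_measurableU mA mB.
have [N [dA dB]] := dep_common (depthP mA) (depthP mB).
have dAB : dep N (A `|` B) by exact: (dep_comp2 or).
rewrite /premeasure !(@cprobE 0%N N N)//.
have -> : ind (A `|` B) = (fun w => ind A w + ind B w).
  apply/funext => w; rewrite /ind -EFinD !indicE in_setU.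
  have [wA|] := boolP (w \in A); last by rewrite add0r.
  have [wB|] := boolP (w \in B); last by rewrite addr0.
  have : (A `&` B) w by split; exact: set_mem.
  by rewrite AB0.
by rewrite cexpD//; exact: nice_ind.
Qed.

HB.instance Definition _ := isContent.Build _ (horizon S) R premeasure
  premeasure_ge0 premeasure_additive.

Let premeasure_sub : measurable_subset_sigma_subadditive premeasure.
Proof.
move=> C F mF mC CF; rewrite leNgt; apply/negP => lt0.
pose bad j := [set w : W | \sum_(n <oo) cprob j (F n) w < cprob j C w].
have badS j w : exists y, bad j w -> bad j.+1 (upd w j y).
  have [b|nb] := pselect (bad j w); last by exists point.
  have [y hy] : exists y, bad j.+1 (upd w j y); last by exists y.
  apply: (@step_gt j (cprob j.+1 C) (fun n => cprob j.+1 (F n))).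
  - exact: (nice_cprob _ mC).
  - by move=> n; exact: (nice_cprob _ (mF n)).
  - rewrite -(cprobS _ mC).
    by under eq_eseriesr => n _ do rewrite -(cprobS _ (mF n)).
have [y hy] := choice (fun p : nat * W => badS p.1 p.2).
pose u := fix u n : W := if n is m.+1 then upd (u m) m (y (m, u m)) else point.
have bu n : bad n (u n).
  by elim: n => //= n IH; exact: (hy (n, u n)).
pose w : W := fun i => u i.+1 i.
have uS i j : (i < j)%N -> u j i = w i.
  elim: j => // j IH; rewrite ltnS leq_eqVlt => /predU1P[->//|ij] /=.
  by rewrite /upd ltn_eqF// IH.
have uE j E : horizon_measurable E -> (depth E <= j)%N ->
    cprob j E (u j) = ind E w.
  move=> mE dE; rewrite cprob_ind//.
  by apply: (dep_ind (depthP mE)) => i id; apply/uS/(leq_trans id).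
have Cw : C w.
  have := bu (depth C); rewrite /bad/= (uE _ _ mC (leqnn _)) /ind indicE.
  case: (boolP ((w : horizon S) \in C)) => [/set_mem//|_] /=.
  rewrite ltNge nneseries_ge0// => n _ _.
  exact: (nice_cprob _ (mF n)).1.
have [n _ Fw] := CF _ Cw.
have := bu (maxn (depth C) (depth (F n))); set J := maxn _ _.
rewrite /bad/= (uE _ _ mC (leq_maxl _ _)).
have -> : ind C w = cprob J (F n) (u J).
  by rewrite (uE _ _ (mF n) (leq_maxr _ _)) /ind !indicE !mem_set.
rewrite ltNge => /negP; apply.
rewrite (@nneseriesD1 _ _ n)//; last first.
  by move=> i _; exact: (nice_cprob _ (mF i)).1.
by rewrite leeDl// nneseries_ge0// => i _ _; exact: (nice_cprob _ (mF i)).1.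
Qed.

HB.instance Definition _ := Content_SigmaSubAdditive_isMeasure.Build
  _ R (horizon S) premeasure premeasure_sub.

Definition law : set W -> \bar R := measure_extension premeasure.

Let law0 : law set0 = 0. Proof. exact: measure0. Qed.

Let law_ge0 C : 0 <= law C. Proof. exact: measure_ge0. Qed.

Let law_sigma_additive : semi_sigma_additive law.
Proof.
have mE : (measurable : set (set W)) =
    (measurable : set (set (g_sigma_algebraType (@horizon_measurable _ S)))).
  by rewrite -horizon_sigma.
move=> F mF tF mUF.
apply: (@measure_semi_sigma_additive _ _ _ (measure_extension premeasure)) => //.
- by move=> i; have := mF i; rewrite mE.
- by rewrite mE in mUF.
Qed.

HB.instance Definition _ :=
  isMeasure.Build _ _ _ law law0 law_ge0 law_sigma_additive.

Lemma lawE (C : set (horizon S)) : horizon_measurable C -> law C = premeasure C.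
Proof. by move=> mC; exact: measurable_mu_extE. Qed.

Lemma horizon_cylinder (A : (set S)^nat) n : (forall i, measurable (A i)) ->
  horizon_measurable (cylinder A n) /\ dep n.+1 (cylinder A n).
Proof.
move=> mA; have dA : dep n.+1 (cylinder A n).
  move=> w w' ww'; apply/propext; split => h i ilen.
    by rewrite -ww' ?ltnS//; exact: h.
  by rewrite ww' ?ltnS//; exact: h.
by split => //; split; [exact: measurable_cylinder|exists n.+1].
Qed.

Lemma integral_cylinder (A : (set S)^nat) j w (F : S -> \bar R) :
  \int[next j.+1 w]_y (ind (cylinder A j.+1) (upd w j.+1 y) * F y) =
  ind (cylinder A j) w * \int[next j.+1 w]_(y in A j.+1) F y.
Proof.
rewrite /ind indicE; case: (boolP ((w : horizon S) \in _)) => [/set_mem wA|].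
  rewrite mul1e [RHS]integral_mkcond; apply: eq_integral => y _.
  rewrite indicE patchE; suff -> : ((upd w j.+1 y : horizon S) \in
      (cylinder A j.+1 : set (horizon S))) = (y \in A j.+1).
    by case: (y \in A j.+1); rewrite ?mul1e ?mul0e.
  apply/idP/idP => /set_mem h; apply/mem_set.
    by have := h j.+1 (leqnn _); rewrite /upd eqxx.
  move=> i; rewrite leq_eqVlt => /predU1P[->|]; first by rewrite /upd eqxx.
  by move=> ij; rewrite /upd ltn_eqF//; exact: wA.
move=> /negP wA; rewrite mul0e integral0_eq// => y _; rewrite indicE memNset ?mul0e//.
move=> h; apply: wA; apply/mem_set => i ij.
by have := h i (leqW ij); rewrite /upd ltn_eqF.
Qed.

Lemma cexp_cylinder (A : (set S)^nat) j m w :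
  cexp j.+1 m (ind (cylinder A (j + m))) w =
  ind (cylinder A j) w * chain_weight k (fun i => A (j + i).+1) m (w j).
Proof.
elim: m j w => [|m IH] j w /=; first by rewrite addn0 mule1.
rewrite addnS -addSn /step; under eq_integral do rewrite IH.
rewrite (integral_cylinder A j w
  (fun y => chain_weight k (fun i => A (j.+1 + i).+1) m (upd w j.+1 y j.+1))).
rewrite addn0 /=; congr (_ * _); apply: eq_integral => y _.
rewrite /upd eqxx; congr (chain_weight k _ m y).
by apply/funext => i; rewrite addSnnS.
Qed.

Lemma law_cylinder (A : (set S)^nat) n : (forall i, measurable (A i)) ->
  law (cylinder A n) =
  \int[mu]_(s in A 0%N) chain_weight k (fun i => A i.+1) n s.
Proof.
move=> mA; have [mC dC] := horizon_cylinder n mA.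
rewrite lawE// /premeasure (@cprobE 0 n.+1 n.+1)// /= /step [RHS]integral_mkcond.
apply: eq_integral => y _; rewrite (cexp_cylinder A 0) patchE /ind indicE.
rewrite /upd eqxx; suff -> : ((fun i => if i == 0%N then y else point i : S) \in
    (cylinder A 0 : set (horizon S))) = (y \in A 0%N).
  by case: (y \in A 0%N); rewrite ?mul1e ?mul0e.
apply/idP/idP => /set_mem h; apply/mem_set; first exact: (h 0%N).
by case.
Qed.

Let law_setT : law setT = 1.
Proof.
have -> : [set: W] = cylinder (fun=> setT) 0 by apply/seteqP; split.
rewrite law_cylinder//= (integral_cst mu measurableT 1) mul1e.
exact: probability_setT.
Qed.

HB.instance Definition _ := Measure_isProbability.Build _ _ _ law law_setT.

Lemma exists_path_law : exists P : probability W R, is_path_law k mu P.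
Proof. by exists law => A n mA; exact: law_cylinder. Qed.

End construction.
End IonescuTulcea.

Section events.
Context d (S : measurableType d).

Definition eventually_in (B : set S) : set (path_space S) :=
  [set w | exists i : nat, B (w i)].

Definition bounded_eventually_in (m : nat) (B : set S) : set (path_space S) :=
  [set w | exists2 i : nat, (i <= m)%N & B (w i)].

End events.

Section path_law.
Context d (S : measurableType d) (R : realType) (k : R.-pker S ~> S).

Definition path_law (mu : probability S R) : probability (path_space S) R :=
  sval (cid (IonescuTulcea.exists_path_law k mu)).

Lemma path_lawP mu : is_path_law k mu (path_law mu).
Proof. by rewrite /path_law; case: cid. Qed.

Definition avoid_set (B : set S) : set S :=
  [set s | path_law \d_s (eventually_in B) = 0].

Definition attractor (B : set S) :=
  measurable B /\ forall mu, path_law mu (eventually_in B) = 1.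

Definition decisive (B : set S) :=
  forall mu, path_law mu (eventually_in B `|` eventually_in (avoid_set B)) = 1.

Definition Omega (mu : probability S R) (A : set S) : \bar R :=
  \int[mu]_s k s A.

End path_law.

(* at most countable state space with the discrete sigma-algebra *)
Definition denumerable d (S : measurableType d) :=
  countable [set: S] /\ forall A : set S, measurable A.

Definition abstraction d1 d2 (S1 : measurableType d1) (S2 : measurableType d2)
    (R : realType) (k1 : R.-pker S1 ~> S1) (k2 : R.-pker S2 ~> S2)
    (alpha : {mfun S1 >-> S2}) :=
  forall (mu : probability S1 R) (A : set S2), measurable A ->
    pushforward (Omega k1 mu) alpha A = 0 <->
    Omega k2 (distribution mu alpha) A = 0.

Definition alpha_closed (T1 T2 : Type) (alpha : T1 -> T2) (B : set T1) :=
  B = alpha @^-1` (alpha @` B).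

(* Main.v *)
(* Let C be the union of B and its avoid-set. A state over an attractor point s
   either reaches B with probability bounded below by some p_s > 0 or lies in
   the avoid-set, so the finiteness of A2 gives one p > 0 bounding from below
   the probability of reaching C from A1. As A1 is reached almost surely, from
   every state the probability e of never reaching C is at most c = 1 - p.
   Staying out of C for n steps and using this bound at the current state,
   e(s) <= c P_s(out of C up to time n); letting n tend to infinity,
   e(s) <= c e(s), hence e = 0. *)
Require Import Defs.
From mathcomp Require Import all_boot all_order all_algebra.
From mathcomp Require Import all_classical all_reals all_analysis.
From mathcomp Require Import measurable_realfun.

Set Implicit Arguments.
Unset Strict Implicit.
Unset Printing Implicit Defensive.
Import Order.TTheory GRing.Theory Num.Theory.
Import numFieldNormedType.Exports.

Local Open Scope classical_set_scope.
Local Open Scope ring_scope.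
Local Open Scope ereal_scope.

(** * Reachability events on path space *)

Section paths.
Context d (S : measurableType d).

Lemma measurable_eventually_in (B : set S) :
  measurable B -> measurable (eventually_in B).
Proof.
move=> mB; rewrite (_ : eventually_in B =
    \bigcup_i ((fun w : path_space S => w i) @^-1` B)).
  apply: bigcupT_measurable => i; rewrite -[X in measurable X]setTI.
  exact: measurable_coord.
by apply/seteqP; split=> w; [case=> i Bw; exists i|case=> i _ Bw; exists i].
Qed.

Lemma eventually_inU (A B : set S) :
  eventually_in (A `|` B) = eventually_in A `|` eventually_in B.
Proof.
apply/seteqP; split=> w.
  by case=> i [?|?]; [left|right]; exists i.
by case=> -[i ?]; exists i; [left|right].
Qed.

(** Writes an infinite-horizon event as a decreasing limit of cylinders, whose probabilities
    [is_path_law] gives. *)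
Lemma bigcap_cylinder (B : set S) :
  \bigcap_n cylinder (fun=> B) n = ~` eventually_in (~` B).
Proof.
apply/seteqP; split=> w; first by move=> Bw [i]; apply; exact: (Bw i).
by move=> nBw n _ i _; apply: contrapT => nBwi; apply: nBw; exists i.
Qed.

End paths.

(** * Avoidance probabilities at finite horizon *)

Section escape.
Context d (S : measurableType d) (R : realType) (k : R.-pker S ~> S).
Implicit Types (A B C : set S) (s : S) (mu : probability S R).

Definition avoid_upto B n s : \bar R :=
  path_law k \d_s (cylinder (fun=> ~` B) n).

Definition escape B s : \bar R := path_law k \d_s (~` eventually_in B).

Lemma chain_weight_ge0 (A : (set S)^nat) n s : 0 <= chain_weight k A n s.
Proof. by elim: n A s => //= n IH A s; apply: integral_ge0 => t _. Qed.

Lemma measurable_chain_weight (A : (set S)^nat) n :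
  (forall i, measurable (A i)) -> measurable_fun setT (chain_weight k A n).
Proof.
elim: n A => [|n IH] A mA; first exact: measurable_cst.
under [X in measurable_fun _ X]eq_fun do rewrite /= integral_mkcond.
apply: measurable_fun_integral_kernel.
- by move=> U mU; exact: measurable_kernel.
- by move=> t; rewrite patchE; case: ifP => // _; exact: chain_weight_ge0.
- apply/(measurable_restrictT _ (mA 0%N)).
  by apply: measurable_funTS; exact: IH.
Qed.

(** The Dirac factor handles time 0: [chain_weight] constrains only the states after [s]. *)
Lemma avoid_uptoE B n s : measurable B -> avoid_upto B n s =
  \d_s (~` B) * chain_weight k (fun=> ~` B) n s.
Proof.
move=> mB; rewrite /avoid_upto path_lawP; last by move=> _; exact: measurableC.
rewrite integral_dirac//; first exact: measurableC.
apply: measurable_funTS; apply: measurable_chain_weight => _.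
exact: measurableC.
Qed.

Lemma integral_avoid_upto mu B n : measurable B ->
  path_law k mu (cylinder (fun=> ~` B) n) = \int[mu]_s avoid_upto B n s.
Proof.
move=> mB; rewrite path_lawP; last by move=> _; exact: measurableC.
rewrite integral_mkcond; apply: eq_integral => s _; rewrite avoid_uptoE//.
by rewrite patchE diracE; case: ifP; rewrite ?mul1e ?mul0e.
Qed.

(** First-step decomposition: the constant sequence of sets is invariant under the shift in
    [chain_weight]. *)
Lemma avoid_uptoS B n s : measurable B -> avoid_upto B n.+1 s =
  \d_s (~` B) * \int[k s]_t avoid_upto B n t.
Proof.
move=> mB; rewrite avoid_uptoE//= integral_mkcond; congr (_ * _).
apply: eq_integral => t _; rewrite avoid_uptoE//.
by rewrite patchE diracE; case: ifP; rewrite ?mul1e ?mul0e.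
Qed.

Lemma measurable_avoid_upto B n : measurable B ->
  measurable_fun setT (avoid_upto B n).
Proof.
move=> mB; rewrite (_ : avoid_upto B n = fun s =>
    \d_s (~` B) * chain_weight k (fun=> ~` B) n s); last first.
  by apply/funext => s; exact: avoid_uptoE.
apply: emeasurable_funM; first exact/measurable_fun_dirac/measurableC.
by apply: measurable_chain_weight => _; exact: measurableC.
Qed.

Lemma avoid_upto_ge0 B n s : 0 <= avoid_upto B n s.
Proof. exact: measure_ge0. Qed.

Lemma avoid_upto_le1 B n s : measurable B -> avoid_upto B n s <= 1.
Proof.
move=> mB; apply: probability_le1; apply: measurable_cylinder => _.
exact: measurableC.
Qed.

(** * Passage to the infinite horizon *)

Lemma cvg_path_law_cylinder mu B : measurable B ->
  path_law k mu (cylinder (fun=> ~` B) n) @[n --> \oo] -->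
  path_law k mu (~` eventually_in B).
Proof.
move=> mB; rewrite -{2}(setCK B) -bigcap_cylinder.
have mcyl n : measurable (cylinder (fun=> ~` B) n : set (path_space S)).
  by apply: measurable_cylinder => _; exact: measurableC.
apply: (@nonincreasing_cvg_mu _ _ _ (path_law k mu)) => //.
- by rewrite (le_lt_trans (probability_le1 _ (mcyl 0%N)))// ltry.
- exact: bigcapT_measurable.
- move=> m n mn; apply/subsetPset => w h i im; exact/h/(leq_trans im).
Qed.

Lemma cvg_avoid_upto B s : measurable B ->
  avoid_upto B n s @[n --> \oo] --> escape B s.
Proof. exact: cvg_path_law_cylinder. Qed.

Lemma measurable_escape B : measurable B -> measurable_fun setT (escape B).
Proof.
move=> mB; apply: (emeasurable_fun_cvg (avoid_upto B)).
  by move=> n; exact: measurable_avoid_upto.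
by move=> s _; exact: cvg_avoid_upto.
Qed.

Lemma escape_ge0 B s : 0 <= escape B s.
Proof. exact: measure_ge0. Qed.

Lemma escape_le_avoid_upto B n s : measurable B ->
  escape B s <= avoid_upto B n s.
Proof.
move=> mB; apply: le_measure.
- by rewrite inE; apply: measurableC; exact: measurable_eventually_in.
- by rewrite inE; apply: measurable_cylinder => _; exact: measurableC.
- by rewrite -{1}(setCK B) -bigcap_cylinder => w /(_ n I).
Qed.

Lemma escapeE B s : measurable B ->
  escape B s = 1 - path_law k \d_s (eventually_in B).
Proof.
by move=> mB; apply: probability_setC; exact: measurable_eventually_in.
Qed.

Lemma reach_escape B s : measurable B ->
  path_law k \d_s (eventually_in B) = 1 - escape B s.
Proof.
move=> mB; rewrite -[eventually_in B]setCK; apply: probability_setC.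
by apply: measurableC; exact: measurable_eventually_in.
Qed.

(** Dominated convergence with bound 1. Asking only for total mass 1 covers both an initial law and
    a kernel value [k s]. *)
Lemma avoid_upto_cvg_integral (nu : {measure set S -> \bar R}) B :
  measurable B -> nu setT = 1 ->
  \int[nu]_s avoid_upto B n s @[n --> \oo] --> \int[nu]_s escape B s.
Proof.
move=> mB nu1; apply: (@dominated_cvg _ _ _ nu setT _ _ _ (cst 1)) => //.
- by move=> n; exact: measurable_avoid_upto.
- by move=> s _; exact: cvg_avoid_upto.
- apply/integrableP; split; first exact: measurable_cst.
  under eq_integral do rewrite /= normr1.
  by rewrite integral_cst// nu1 mule1 ltry.
- move=> n s _; rewrite gee0_abs; first exact: avoid_upto_le1.
  exact: avoid_upto_ge0.
Qed.

Lemma integral_escape mu B : measurable B ->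
  path_law k mu (~` eventually_in B) = \int[mu]_s escape B s.
Proof.
move=> mB; apply: (@cvg_unique _ (@ereal_hausdorff R)
  (path_law k mu (cylinder (fun=> ~` B) n) @[n --> \oo])).
  exact: cvg_path_law_cylinder.
rewrite /=; under eq_cvg do rewrite integral_avoid_upto//.
exact: avoid_upto_cvg_integral (probability_setT _).
Qed.

(** Both sides are limits of [avoid_upto B n.+1 s], the right one through [avoid_uptoS]. *)
Lemma escape_step B s : measurable B ->
  escape B s = \d_s (~` B) * \int[k s]_t escape B t.
Proof.
move=> mB; apply: (@cvg_unique _ (@ereal_hausdorff R)
  (avoid_upto B n.+1 s @[n --> \oo])).
  by rewrite /= (cvg_shiftS (avoid_upto B ^~ s)); exact: cvg_avoid_upto.
rewrite /=; under eq_cvg do rewrite avoid_uptoS//.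
apply: cvgeZl; first by rewrite diracE.
exact: avoid_upto_cvg_integral (prob_kernel _).
Qed.

Lemma escape_in0 B s : measurable B -> B s -> escape B s = 0.
Proof. by move=> mB Bs; rewrite escape_step// diracE memNset ?mul0e. Qed.

Lemma measurable_avoid_set B : measurable B -> measurable (avoid_set k B).
Proof.
move=> mB; rewrite (_ : avoid_set k B = escape B @^-1` [set 1]).
  by rewrite -[X in measurable X]setTI; exact: (measurable_escape mB).
apply/seteqP; split=> s; rewrite /avoid_set /= escapeE//.
  by move=> ->; rewrite sube0.
(* Finiteness allows cancellation in [1 - x = 1] over the extended reals. *)
have : path_law k \d_s (eventually_in B) \is a fin_num.
  by apply: fin_num_measure; exact: measurable_eventually_in.
by case: (path_law _ _ _) => // r _ [] /eqP; rewrite -subr_eq0 addrAC subrr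
  sub0r oppr_eq0 => /eqP ->.
Qed.

(** * From uniform reachability to almost sure reachability *)

(** An induction on the horizon replaces the strong Markov property at the hitting time of [A]: the
    error term [avoid_upto A n s] tends to [escape A s], which is 0. *)
Lemma escape_le_of_attractor A C (c : R) : (0 <= c)%R ->
  attractor k A -> measurable C -> (forall s, A s -> escape C s <= c%:E) ->
  forall s, escape C s <= c%:E.
Proof.
move=> c0 [mA A1] mC escA.
have bound n s : escape C s <= avoid_upto A n s + c%:E.
  elim: n s => [|n IH] s; (have [As|nAs] := pselect (A s);
    first by rewrite (le_trans (escA _ As))// leeDr// avoid_upto_ge0).
    (* Horizon 0 outside [A]: the error term is already 1, which bounds any probability. *)
    rewrite avoid_uptoE//= diracE mem_set// mul1e.
    rewrite (le_trans (escape_le_avoid_upto 0 s mC))//.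
    by rewrite (le_trans (avoid_upto_le1 0 s mC))// leeDl// lee_fin.
  rewrite avoid_uptoS// diracE mem_set// mul1e escape_step//.
  have -> : \int[k s]_t avoid_upto A n t + c%:E =
      \int[k s]_t (avoid_upto A n t + c%:E).
    rewrite ge0_integralD//; last exact: measurable_avoid_upto.
    by rewrite integral_cst// prob_kernel mule1.
  (* Drops the Dirac factor of [escape_step], which is at most 1. *)
  apply: (@le_trans _ _ (\int[k s]_t escape C t)).
    rewrite diracE; case: (_ \in _); first by rewrite mul1e.
    by rewrite mul0e; apply: integral_ge0 => t _; exact: escape_ge0.
  apply: ge0_le_integral => //.
  - exact: measurable_escape.
  - apply: emeasurable_funD => //; exact: measurable_avoid_upto.
move=> s; have escA0 : escape A s = 0 by rewrite escapeE// A1 subee.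
rewrite -[leRHS]add0e -escA0.
apply: (@cvge_to_ge _ \oo _ _ (fun n => avoid_upto A n s + c%:E)).
  apply: cvgeD; [by rewrite fin_num_adde_defl|exact: cvg_avoid_upto|].
  exact: cvg_cst.
by apply: nearW => n; exact: bound.
Qed.

Lemma escape_eq0 C (c : R) : (0 <= c < 1)%R -> measurable C ->
  (forall s, escape C s <= c%:E) -> forall s, escape C s = 0.
Proof.
move=> /andP[c0 c1] mC escc.
have bound n s : escape C s <= c%:E * avoid_upto C n s.
  have [Cs|nCs] := pselect (C s).
    by rewrite escape_in0// mule_ge0// avoid_upto_ge0.
  elim: n s nCs => [|n IH] s nCs.
    by rewrite avoid_uptoE//= diracE mem_set// !mule1.
  rewrite avoid_uptoS// diracE mem_set// mul1e escape_step//.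
  rewrite diracE mem_set// mul1e -ge0_integralZl_EFin//;
    last exact: measurable_avoid_upto.
  apply: ge0_le_integral => //.
  - exact: measurable_escape.
  - by apply: measurable_funeM; exact: measurable_avoid_upto.
  (* [IH] covers only states outside [C]; inside [C] the left side vanishes. *)
  - move=> t _; have [Ct|] := pselect (C t); last exact: IH.
    by rewrite escape_in0// mule_ge0// avoid_upto_ge0.
move=> s; have : escape C s <= c%:E * escape C s.
  apply: (@cvge_to_ge _ \oo _ _ (fun n => c%:E * avoid_upto C n s)).
    by apply: cvgeZl => //; exact: cvg_avoid_upto.
  by apply: nearW => n; exact: bound.
have := escape_ge0 C s; have := escc s.
(* The bounds 0 and [c] exclude infinite values; then [r * (1 - c) <= 0] with [c < 1] forces
   [r = 0]. *)
case: (escape C s) => // r _; rewrite -EFinM !lee_fin => r0 rcr.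
congr EFin; apply/eqP; rewrite eq_le r0 andbT.
by rewrite -(@pmulr_rle0 _ (1 - c)) ?subr_gt0// mulrBl mul1r subr_le0.
Qed.

Lemma attractor_of_uniform_reach A C (p : R) : (0 < p)%R ->
  attractor k A -> measurable C ->
  (forall s, A s -> p%:E <= path_law k \d_s (eventually_in C)) ->
  attractor k C.
Proof.
move=> p0 attA mC reach; split=> // mu.
have mFC := measurable_eventually_in mC.
(* Truncating [p] at 1 makes the constant nonnegative without having to derive [p <= 1] from a point
   of [A]. *)
have escA s : A s -> escape C s <= (1 - Num.min p 1)%:E.
  move=> As; rewrite escapeE// EFinB leeB// (le_trans _ (reach _ As))//.
  by rewrite lee_fin ge_min lexx.
have c01 : (0 <= 1 - Num.min p 1 < 1)%R.
  by rewrite subr_ge0 ge_min lexx orbT ltrBlDr ltrDl lt_min p0 ltr01.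
have /andP[c0 _] := c01.
have esc0 := escape_eq0 c01 mC (escape_le_of_attractor c0 attA mC escA).
rewrite -[eventually_in C]setCK probability_setC; last exact: measurableC.
rewrite integral_escape// (eq_integral (cst 0)) ?integral0 ?sube0//.
by move=> s _; exact: esc0.
Qed.

End escape.

(** Downward closure in the bound lets the minimum over a list enumerating [A] serve every point. *)
Lemma finite_set_uniform_lower_bound (R : realDomainType) (T : choiceType)
    (A : set T) (P : T -> R -> Prop) : finite_set A ->
  (forall x p q, (p <= q)%R -> P x q -> P x p) ->
  (forall x, A x -> exists2 p, (0 < p)%R & P x p) ->
  exists2 p, (0 < p)%R & forall x, A x -> P x p.
Proof.
move=> /finite_seqP[r ->{A}] Pdown; elim: r => [|x r IH] Pr.
  by exists 1%R.
have [p p0 Pp] : exists2 p, (0 < p)%R & forall y, y \in r -> P y p.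
  by apply: IH => y yr; apply: Pr; rewrite /= inE yr orbT.
have [q q0 Pq] := Pr x (mem_head x r).
exists (Num.min p q); first by rewrite lt_min p0.
move=> y /=; rewrite inE => /predU1P[->|yr].
  by apply: Pdown Pq; rewrite ge_min lexx orbT.
by apply: Pdown (Pp _ yr); rewrite ge_min lexx.
Qed.

Theorem proposition36 (R : realType) (d1 d2 : measure_display)
    (S1 : measurableType d1) (S2 : measurableType d2)
    (k1 : R.-pker S1 ~> S1) (k2 : R.-pker S2 ~> S2)
    (alpha : {mfun S1 >-> S2})
    (S2_denumerable : denumerable S2)
    (k2_abstraction : abstraction k1 k2 alpha)
    (A2 : set S2) (A2_finite : finite_set A2)
    (A2_attractor : attractor k2 A2)
    (A1_attractor : attractor k1 (alpha @^-1` A2))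
    (reach_or_avoid : forall (s : S2) (B : set S1),
      A2 s -> measurable B -> alpha_closed alpha B ->
      exists (p : R) (m : nat), (0 < p)%R /\
        ((forall mu : probability S1 R, mu (alpha @^-1` [set s]) = 1 ->
            p%:E <= path_law k1 mu (bounded_eventually_in m B)) \/
         (forall mu : probability S1 R, mu (alpha @^-1` [set s]) = 1 ->
            path_law k1 mu (eventually_in B) = 0))) :
  forall B : set S1, measurable B -> alpha_closed alpha B -> decisive k1 B.
Proof.
move=> B mB B_closed.
have mC : measurable (B `|` avoid_set k1 B).
  by apply: measurableU => //; exact: measurable_avoid_set.
(* The minimum is taken over the finite set [A2], with the fibre quantified inside the predicate,
   since fibres may be infinite. *)
have [p p0 reach] : exists2 p : R, (0 < p)%R & forall s, A2 s ->
    forall x, alpha x = s ->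
    p%:E <= path_law k1 \d_x (eventually_in (B `|` avoid_set k1 B)).
  apply: (finite_set_uniform_lower_bound (P := fun s p => forall x,
      alpha x = s ->
      p%:E <= path_law k1 \d_x (eventually_in (B `|` avoid_set k1 B)))) => //.
    by move=> s p q pq h x /h; apply: le_trans; rewrite lee_fin.
  move=> s As; have [p [m [p0 hp]]] := reach_or_avoid s B As mB B_closed.
  (* Dirac measures are admissible in [reach_or_avoid], so its alternatives apply pointwise on the
     fibre. *)
  have dirac1 x : alpha x = s -> \d_x (alpha @^-1` [set s]) = 1 :> \bar R.
    by move=> xs; rewrite diracE mem_set.
  case: hp => [hp|avoid]; [exists p => // x /dirac1/hp|exists 1%R => // x xs].
    move=> /le_trans; apply; apply: le_measure.
    - rewrite inE (_ : bounded_eventually_in m B = \bigcup_(i in `I_m.+1)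
          ((fun w : path_space S1 => w i) @^-1` B)).
        apply: bigcup_measurable => i _; rewrite -[X in measurable X]setTI.
        exact: measurable_coord.
      by apply/seteqP; split=> w [i im Bw]; exists i.
    - by rewrite inE; exact: measurable_eventually_in.
    - by move=> w [i _ Bw]; exists i; left.
  (* Second alternative: [x] itself lies in the avoid-set, so the union is hit at time 0 and the
     bound 1 works. *)
  by rewrite reach_escape// escape_in0 ?sube0//; right; exact/avoid/dirac1.
have [_ C1] := attractor_of_uniform_reach p0 A1_attractor mC
  (fun x Ax => reach _ Ax x erefl).
by move=> mu; rewrite -eventually_inU; exact: C1.
Qed.
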